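(* There is an absolute constant $\epsilon_0>0$ such that the following holds for every $0<\epsilon\le\epsilon_0$ and all positive integers $k,d$. Let $G=([N],E)$ be a graph of maximum degree $d$ and $s\in[N]$, and let $R=k(4d/\epsilon)^{4k+2}$. If the $R$-neighborhood of $s$ in $G$ is $\epsilon$-expanding, then the subgraph of $G$ induced by the vertices at distance at most $R$ from $s$ contains a $T$-minor for every tree $T$ with at most $k$ vertices.
   Context: The $R$-neighborhood of $s$ in $G$ is $\epsilon$-expanding if for every vertex set $S\subseteq[N]$ with $\max_{u\in S}\mathrm{dist}_G(s,u)\le R$, the number of edges of $G$ with exactly one endpoint in $S$ is at least $\epsilon|S|d$. $G$ has a $T$-minor if $T$ is obtainable from $G$ by vertex deletions, edge deletions and edge contractions. *)

(* Defs.v *)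
From mathcomp Require Import all_boot all_order all_algebra.
From mathcomp Require Import all_classical all_reals ereal.

Set Implicit Arguments.
Unset Strict Implicit.
Unset Printing Implicit Defensive.

Import Order.TTheory GRing.Theory Num.Theory.
Local Open Scope ring_scope.

Record sgraph (V : finType) := SGraph {
  adj : rel V;
  adj_sym : symmetric adj;
  adj_irr : irreflexive adj }.

Definition edges (V : finType) (G : sgraph V) : {set {set V}} :=
  [set e : {set V} | [exists x, exists y, adj G x y && (e == [set x; y]%SET)]]%SET.

Definition boundary (V : finType) (G : sgraph V) (S : {set V}) : {set {set V}} :=
  [set e in edges G | #|e :&: S| == 1%N]%SET.

Definition degree (V : finType) (G : sgraph V) (x : V) : nat :=
  #|[set y | adj G x y]%SET|.

Definition max_degree (V : finType) (G : sgraph V) : nat :=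
  (\max_(x : V) degree G x)%N.

(* Length of a shortest walk; +oo when y is not reachable from x. *)
Definition gdist (R : realType) (V : finType) (G : sgraph V) (x y : V) : \bar R :=
  ereal_inf [set (size p)%:R%:E | p in
    [set p : seq V | path (adj G) x p /\ last x p = y]]%classic.

Definition gball (R : realType) (V : finType) (G : sgraph V) (s : V) (r : R) :
    {set V} :=
  [set u | (gdist R G s u <= r%:E)%E]%SET.

Definition expanding_nbhd (R : realType) (V : finType) (G : sgraph V) (d : nat)
    (s : V) (r eps : R) : Prop :=
  forall S : {set V}, (forall u, u \in S -> (gdist R G s u <= r%:E)%E) ->
    eps * #|S|%:R * d%:R <= #|boundary G S|%:R.

Definition is_tree (V : finType) (G : sgraph V) : Prop :=
  [/\ (0 < #|V|)%N,
      forall x y, connect (adj G) x y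
    & forall c : seq V, ucycle (adj G) c -> (size c <= 2)%N].

Definition graph_iso (V W : finType) (G : sgraph V) (H : sgraph W) : Prop :=
  exists2 f : V -> W, bijective f & forall x y, adj H (f x) (f y) = adj G x y.

Section Operations.
Variables (V : finType) (G : sgraph V).

Definition induced_adj (A : {set V}) : rel {x : V | x \in A} :=
  fun x y => adj G (val x) (val y).

Fact induced_sym A : symmetric (@induced_adj A).
Proof. by move=> x y; apply: adj_sym. Qed.

Fact induced_irr A : irreflexive (@induced_adj A).
Proof. by move=> x; apply: adj_irr. Qed.

Definition induced (A : {set V}) := SGraph (@induced_sym A) (@induced_irr A).

Definition del_vertex (v : V) := induced [set~ v]%SET.

Definition del_edge_adj (u v : V) : rel V :=
  fun x y => adj G x y && ([set x; y]%SET != [set u; v]%SET).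

Fact del_edge_sym u v : symmetric (del_edge_adj u v).
Proof. by move=> x y; rewrite /del_edge_adj adj_sym finset.setUC. Qed.

Fact del_edge_irr u v : irreflexive (del_edge_adj u v).
Proof. by move=> x; rewrite /del_edge_adj adj_irr. Qed.

Definition del_edge (u v : V) := SGraph (@del_edge_sym u v) (@del_edge_irr u v).

(* Contraction of the edge uv: v is merged into u, loops and parallel edges
   are suppressed. *)
Definition contract_adj (u v : V) : rel {x : V | x \in [set~ v]%SET} :=
  fun x y => (x != y) &&
    [|| adj G (val x) (val y),
        (val x == u) && adj G v (val y)
      | (val y == u) && adj G v (val x)].

Fact contract_sym u v : symmetric (@contract_adj u v).
Proof.
move=> x y; rewrite /contract_adj eq_sym adj_sym.
by congr (_ && (_ || _)); rewrite orbC.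
Qed.

Fact contract_irr u v : irreflexive (@contract_adj u v).
Proof. by move=> x; rewrite /contract_adj eqxx. Qed.

Definition contract (u v : V) := SGraph (@contract_sym u v) (@contract_irr u v).

End Operations.

Inductive has_minor (W : finType) (T : sgraph W) :
    forall V : finType, sgraph V -> Prop :=
| minor_iso (V : finType) (G : sgraph V) :
    graph_iso G T -> has_minor T G
| minor_del_vertex (V : finType) (G : sgraph V) (v : V) :
    has_minor T (del_vertex G v) -> has_minor T G
| minor_del_edge (V : finType) (G : sgraph V) (u v : V) :
    adj G u v -> has_minor T (del_edge G u v) -> has_minor T G
| minor_contract (V : finType) (G : sgraph V) (u v : V) :
    adj G u v -> has_minor T (contract G u v) -> has_minor T G.

(* Main.v *)
Require Import Defs.
From mathcomp Require Import all_boot all_order all_algebra zify.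

(** Write [inner Z] for the vertices of [Z] having a neighbour outside [Z]. Expansion gives
    [eps * #|Z| <= #|inner Z|] for [Z] in the ball, so a connected [Z] containing [s] with
    [#|inner Z| <= k] has at most [k / eps <= r] vertices, and its neighbours are still in
    the ball. As in Diestel's proof of the path-width theorem, grow a set [X] together with
    a minor model of a subtree [U] of [T] whose branch sets each reach [inner X], with
    [#|inner X| = #|U|], keeping [X] maximal: every larger connected [Z] has
    [#|inner Z| > #|U|]. A new vertex of [T] attached to [t] is modelled by a neighbour
    [x] outside [X] of the boundary vertex of the branch set of [t]; maximality forces
    [inner (x |: X) = x |: inner X]. A largest [Y] containing [x |: X] with
    [#|inner Y| <= #|U| + 1] restores the invariant, the branch sets being prolonged to
    [inner Y] along disjoint paths. *)

Set Implicit Arguments.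
Unset Strict Implicit.
Unset Printing Implicit Defensive.

(** An edge may be sent to a walk, possibly empty: a contraction collapses some edges to a point. *)
Lemma connect_homo (A B : finType) (e : rel A) (e' : rel B) (m : A -> B) :
  (forall a b, e a b -> connect e' (m a) (m b)) ->
  forall a b, connect e a b -> connect e' (m a) (m b).
Proof.
move=> h a b /connectP[p pth ->]; elim: p a pth => [|c p IHp] a //= /andP[ac pth].
exact: connect_trans (h _ _ ac) (IHp _ pth).
Qed.

(** * Hall's marriage theorem *)

Section Hall.
Variables (S T : finType).
Implicit Types (r : S -> T -> bool) (A Q : {set S}).

Definition nbrs r Q := [set y | [exists x in Q, r x y]].

Lemma nbrsP r Q y : reflect (exists2 x, x \in Q & r x y) (y \in nbrs r Q).
Proof. by rewrite inE; exact: exists_inP. Qed.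

(** Induction on [#|A|]. If some nonempty proper [Q] is tight, [Q] is matched into its neighbours
    and [A :\: Q] into the remaining vertices. Otherwise any edge from [x0] to [y1] may be taken,
    since every other set has a neighbour to spare. [y0] is a default value for empty [A]. *)
Lemma Hall_matching (y0 : T) r A :
  (forall Q, Q \subset A -> #|Q| <= #|nbrs r Q|) ->
  exists2 f : S -> T, {in A, forall x, r x (f x)} & {in A &, injective f}.
Proof.
have [n] := ubnP #|A|; elim: n r A => // n IHn r A; rewrite ltnS => leAn hall.
have [->|[x0 x0A]] := set_0Vmem A.
  by exists (fun=> y0) => x; rewrite inE.
have [/existsP[Q /and4P[QA Q0 QnA tight]]|] :=
  boolP [exists Q : {set S}, [&& Q \subset A, Q != set0, Q != A & #|nbrs r Q| <= #|Q|]].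
  have QpA : Q \proper A by rewrite properEneq QnA.
  have [||f fr finj] := IHn r Q.
  - exact: leq_trans (proper_card QpA) leAn.
  - by move=> P PQ; apply: hall; apply: subset_trans PQ QA.
  have [||g gr ginj] := IHn (fun x y => r x y && (y \notin nbrs r Q)) (A :\: Q).
  - have := cardsID Q A; rewrite (setIidPr QA) => cA.
    by apply: leq_trans leAn; rewrite -cA -[X in X < _]add0n ltn_add2r card_gt0.
  - move=> P; rewrite subsetD => /andP[PA PQ].
    (* Hall's condition for [P :|: Q], less the at most [#|Q|] neighbours of [Q], is the condition
       for [P] in the reduced relation. *)
    have := hall (P :|: Q); rewrite subUset PA QA cardsU.
    have -> : P :&: Q = set0 by apply/eqP; rewrite setI_eq0.
    rewrite cards0 subn0 => /(_ isT) h.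
    have : nbrs r (P :|: Q) \subset
           nbrs r Q :|: nbrs (fun x y => r x y && (y \notin nbrs r Q)) P.
      apply/subsetP=> y /nbrsP[x]; rewrite inE => xPQ rxy.
      rewrite inE; case: (boolP (y \in nbrs r Q)) => //= yQ.
      apply/nbrsP; exists x; last by rewrite rxy.
      case/orP: xPQ => // xQ; case/negP: yQ; apply/nbrsP; by exists x.
    move/subset_leq_card => h2.
    have h3 := leq_trans h (leq_trans h2 (leq_card_setU _ _)).
    rewrite -(leq_add2r #|Q|); apply: leq_trans h3 _.
    by rewrite addnC leq_add2l.
  exists (fun x => if x \in Q then f x else g x) => [x xA|x y xA yA].
    case: ifP => xQ; first exact: fr.
    by have := gr x; rewrite !inE xQ xA => /(_ isT)/andP[].
  have Qf z : z \in Q -> f z \in nbrs r Q by move=> zQ; apply/nbrsP; exists z; rewrite ?fr.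
  have Qg z : z \in A -> z \in Q = false -> g z \notin nbrs r Q.
    by move=> zA zQ; have := gr z; rewrite inE zQ zA => /(_ isT)/andP[].
  case: ifP => xQ; case: ifP => yQ.
  - exact: finj.
  - by move=> e; have := Qg y yA yQ; rewrite -e Qf.
  - by move=> e; have := Qg x xA xQ; rewrite e Qf.
  - by apply: ginj; rewrite !inE ?xQ ?yQ.
rewrite negb_exists => /forallP loose.
have [y1 rxy] : exists y1, r x0 y1.
  have := hall [set x0]; rewrite sub1set cards1 => /(_ x0A) /card_gt0P[y].
  by case/nbrsP=> x; rewrite inE => /eqP->; exists y.
have [||f fr finj] := IHn (fun x y => r x y && (y != y1)) (A :\ x0).
- by apply: leq_trans leAn; rewrite [X in _ < X](cardsD1 x0) x0A.
- move=> P; rewrite subsetD1 => /andP[PA x0P].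
  have [->|P0] := eqVneq P set0; first by rewrite cards0.
  have PnA : P != A by apply: contraNneq x0P => ->.
  have := loose P; rewrite PA P0 PnA /= -ltnNge => lt.
  rewrite -ltnS; apply: leq_trans lt _.
  have sub : nbrs r P \subset y1 |: nbrs (fun x y => r x y && (y != y1)) P.
    apply/subsetP=> y /nbrsP[x xP rx]; rewrite in_setU1.
    by case: eqVneq => //= ny; apply/nbrsP; exists x; rewrite ?rx.
  apply: leq_trans (subset_leq_card sub) _.
  by apply: leq_trans (leq_card_setU _ _) _; rewrite cards1.
exists (fun x => if x == x0 then y1 else f x) => [x xA|x y xA yA].
  by case: eqVneq => [->//|nx]; have := fr x; rewrite !inE nx xA => /(_ isT)/andP[].
have fy z : z \in A -> z != x0 -> f z != y1.
  by move=> zA nz; have := fr z; rewrite !inE nz zA => /(_ isT)/andP[].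
case: eqVneq => [->|nx]; case: eqVneq => [->|ny] //.
- by move=> e; have := fy y yA ny; rewrite e eqxx.
- by move=> e; have := fy x xA nx; rewrite e eqxx.
- by apply: finj; rewrite !inE ?nx ?ny.
Qed.

End Hall.

(** * Minors from branch sets *)

Section MinorModel.
Variables (W : finType) (T : sgraph W).

(** Branch sets are the fibres of [phi] over [Some t], hence disjoint by construction; [None] marks
    the vertices in no branch set. *)
Definition fibre_adj (V : finType) (G : sgraph V) (phi : V -> option W) : rel V :=
  fun a b => [&& adj G a b, phi a == phi b & phi a != None].

Definition minor_model (V : finType) (G : sgraph V) (phi : V -> option W) : Prop :=
  [/\ forall t, exists a, phi a = Some t,
      forall a b, phi a = phi b -> phi a != None -> connect (fibre_adj G phi) a b
    & forall t u, adj T t u ->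
        exists a b, [/\ phi a = Some t, phi b = Some u & adj G a b]].

Lemma minor_model_del_vertex (V : finType) (G : sgraph V) phi v :
  phi v = None -> minor_model G phi ->
  minor_model (del_vertex G v) (fun x => phi (val x)).
Proof.
move=> pv [surj conn edge].
have out a : phi a != None -> a \in [set~ v].
  by move=> pa; rewrite !inE; apply: contraNneq pa => ->; rewrite pv.
have outS a t : phi a = Some t -> a \in [set~ v] by move=> e; apply: out; rewrite e.
split.
- move=> t; have [a pa] := surj t.
  by exists (Sub a (outS _ _ pa)); rewrite SubK.
- move=> a b e na.
  (* [insubd a] sends [v] to the arbitrary vertex [a], harmlessly, as [v] lies in no branch set. *)
  have := @connect_homo _ _ _ (fibre_adj (del_vertex G v) (fun x => phi (val x)))
    (insubd a) _ _ _ (conn _ _ e na).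
  rewrite !valKd; apply=> c d /and3P[cd ecd nc]; apply: connect1.
  have nd : phi d != None by rewrite -(eqP ecd).
  by rewrite /fibre_adj /= /induced_adj !insubdK ?out // cd ecd nc.
- move=> t u /edge[a [b [pa pb ab]]].
  exists (Sub a (outS _ _ pa)), (Sub b (outS _ _ pb)).
  by rewrite /= /induced_adj !SubK.
Qed.

Lemma minor_model_contract (V : finType) (G : sgraph V) phi u v :
  adj G u v -> phi u = phi v -> minor_model G phi ->
  minor_model (contract G u v) (fun x => phi (val x)).
Proof.
move=> uv puv [surj conn edge].
have nuv : u != v by apply: contraTneq uv => ->; rewrite adj_irr.
have uin : u \in [set~ v] by rewrite !inE.
pose u' : {x | x \in [set~ v]} := Sub u uin.
(* The quotient map of the contraction: [v] is the only vertex outside the subtype, and the default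
   value [u'] is the vertex it is merged into. *)
pose m a : {x | x \in [set~ v]} := insubd u' a.
have mE a : val (m a) = if a == v then u else a.
  by rewrite /m val_insubd !inE; case: eqVneq.
have pm a : phi (val (m a)) = phi a by rewrite mE; case: eqVneq => // ->.
have madj a b : adj G a b -> m a != m b -> adj (contract G u v) (m a) (m b).
  move=> ab nab; rewrite /= /contract_adj nab /= !mE.
  case: (eqVneq a v) ab => [->|na] ab; case: (eqVneq b v) ab => [->|nb] ab.
  - by rewrite adj_irr in ab.
  - by rewrite eqxx ab orbT.
  - by rewrite eqxx [adj G v a]adj_sym ab !orbT.
  - by rewrite ab.
split.
- by move=> t; have [a pa] := surj t; exists (m a); rewrite pm.
- move=> a b e na.
  have := @connect_homo _ _ _ (fibre_adj (contract G u v) (fun x => phi (val x)))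
    m _ _ _ (conn _ _ e na).
  have mK x : m (val x) = x by apply: valKd.
  rewrite !mK; apply=> c d /and3P[cd ecd nc].
  have [->|nmcd] := eqVneq (m c) (m d); first exact: connect0.
  by apply: connect1; rewrite /fibre_adj madj // !pm ecd nc.
- move=> t w tw; have [a [b [pa pb ab]]] := edge _ _ tw.
  exists (m a), (m b); rewrite !pm; split=> //; apply: madj => //.
  apply: contraTneq tw => mab.
  have : Some t = Some w by rewrite -pa -pb -pm mab pm.
  by case=> ->; rewrite adj_irr.
Qed.

(** Injectivity makes branch sets single vertices, so that losing an edge cannot disconnect one. *)
Lemma minor_model_del_edge (V : finType) (G : sgraph V) phi u v :
  injective phi -> (forall t w, phi u = Some t -> phi v = Some w -> ~~ adj T t w) ->
  minor_model G phi -> minor_model (del_edge G u v) phi.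
Proof.
move=> inj nadj [surj conn edge]; split=> //.
- by move=> a b /inj-> _; exact: connect0.
- move=> t w tw; have [a [b [pa pb ab]]] := edge _ _ tw.
  exists a, b; split=> //; rewrite /= /del_edge_adj ab /=.
  apply/negP=> /eqP/setP e.
  have := e a; have := e b; rewrite !inE !eqxx orbT /= => hb ha.
  have nab : a != b by apply: contraTneq ab => ->; rewrite adj_irr.
  case/esym/orP: ha => /eqP ea; case/esym/orP: hb => /eqP eb; subst.
  - by rewrite eqxx in nab.
  - by have := nadj _ _ pa pb; rewrite tw.
  - by have := nadj _ _ pb pa; rewrite adj_sym tw.
  - by rewrite eqxx in nab.
Qed.

(** Induction on the number of vertices, then of adjacent pairs: delete vertices outside the branch
    sets, contract edges inside them, and delete edges that represent no edge of [T]. When nothing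
    is left to do, [phi] is an isomorphism. *)
Lemma has_minor_of_model (V : finType) (G : sgraph V) phi :
  minor_model G phi -> has_minor T G.
Proof.
have [n] := ubnP #|V|; elim: n => // n IHn in V G phi *; rewrite ltnS => leVn.
have [m] := ubnP #|[set p : V * V | adj G p.1 p.2]|.
elim: m => // m IHm in G phi *; rewrite ltnS => leEm model.
have lt_sub (v : V) : #|{: {x | x \in [set~ v]}}| < n.
  rewrite card_sig (eq_card (B := [set~ v])) // cardsC1.
  by apply: leq_trans leVn; rewrite (cardD1 v).
have [v /eqP pv|all_some] := pickP (fun v => phi v == None).
  exact: minor_del_vertex (IHn _ _ _ (lt_sub v) (minor_model_del_vertex pv model)).
have [[u v] /= /andP[uv /eqP puv]|no_inner] :=
    pickP (fun p : V * V => adj G p.1 p.2 && (phi p.1 == phi p.2)).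
  exact: minor_contract uv (IHn _ _ _ (lt_sub v) (minor_model_contract uv puv model)).
(* A connected fibre without an internal edge is a single vertex. *)
have inj : injective phi.
  move=> a b e; have [_ conn _] := model.
  have na : phi a != None by rewrite all_some.
  case/connectP: (conn _ _ e na) => [[|c p] //=].
  case/andP=> /and3P[ac eac _] _ _.
  by have := no_inner (a, c); rewrite /= ac eac.
have [[u v] /= /andP[uv nuv]|tight] :=
    pickP (fun p : V * V => adj G p.1 p.2 &&
      ~~ [exists t, exists w, [&& phi p.1 == Some t, phi p.2 == Some w & adj T t w]]).
  have model' : minor_model (del_edge G u v) phi.
    apply: minor_model_del_edge => // t w pu pv; apply: contra nuv => tw.
    by apply/existsP; exists t; apply/existsP; exists w; rewrite pu pv !eqxx.
  apply: (minor_del_edge uv); apply: IHm model'.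
  apply: leq_trans leEm; apply: proper_card; apply/properP; split.
    by apply/subsetP=> -[a b]; rewrite !inE /= => /andP[].
  by exists (u, v); rewrite inE /=; [|rewrite /del_edge_adj eqxx andbF].
have [surj conn edge] := model.
have [f fE] : exists f : V -> W, forall a, phi a = Some (f a).
  apply: (@fin_all_exists _ (fun=> W) (fun a t => phi a = Some t)) => a.
  by have := all_some a; case: (phi a) => // t _; exists t.
have [g gE] : exists g : W -> V, forall t, phi (g t) = Some t.
  exact: (@fin_all_exists _ (fun=> V) (fun t a => phi a = Some t)).
apply: minor_iso; exists f.
  exists g => [a|t]; first by apply: inj; rewrite gE fE.
  by have := gE t; rewrite fE => -[].
move=> a b; apply/idP/idP => [/edge[c [d [pc pd cd]]]|ab].
  have -> : a = c by apply: inj; rewrite pc fE.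
  by have -> : b = d by apply: inj; rewrite pd fE.
have := tight (a, b); rewrite /= ab /= => /negbFE/existsP[t /existsP[w]].
by rewrite !fE => /and3P[/eqP[->] /eqP[->]].
Qed.

End MinorModel.

(** * Walks, inner boundaries, connected sets and linkages *)

Lemma connect_last (A : finType) (e : rel A) a u :
  connect e a u -> u = a \/ exists2 x, connect e a x & e x u.
Proof.
case/connectP=> p; case/lastP: p => [|p y] /=; first by left.
rewrite rcons_path last_rcons => /andP[pth ey] ->; right.
by exists (last a p) => //; apply/connectP; exists p.
Qed.

Lemma connect_ind (A : finType) (e : rel A) a (P : A -> Prop) :
  P a -> (forall x y, connect e a x -> P x -> e x y -> P y) ->
  forall u, connect e a u -> P u.
Proof.
move=> Pa Pe u /connectP[p]; elim/last_ind: p u => [|p y IHp] u /=; first by move=> _ ->.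
rewrite rcons_path last_rcons => /andP[pth ey] ->.
by apply: Pe ey; [apply/connectP; exists p | apply: IHp].
Qed.

Section InnerBoundary.
Variables (V : finType) (G : sgraph V).
Implicit Types (X Y Z Q : {set V}) (s u w a : V).

Definition inner Z : {set V} := [set u in Z | [exists w, adj G u w && (w \notin Z)]].

Lemma innerP Z u :
  reflect (u \in Z /\ exists2 w, adj G u w & w \notin Z) (u \in inner Z).
Proof.
rewrite inE; apply: (iffP andP) => [[uZ /existsP[w /andP[uw wZ]]]|[uZ [w uw wZ]]].
  by split=> //; exists w.
by split=> //; apply/existsP; exists w; rewrite uw.
Qed.

Lemma inner_sub Z : inner Z \subset Z.
Proof. by apply/subsetP=> u /innerP[]. Qed.

Lemma notin_inner Z u w : u \in Z -> u \notin inner Z -> adj G u w -> w \in Z.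
Proof.
move=> uZ uI uw; apply: contraNT uI => wZ.
by apply/innerP; split=> //; exists w.
Qed.

Definition within Z : rel V := fun a b => [&& a \in Z, b \in Z & adj G a b].

Lemma within_sym Z : connect_sym (within Z).
Proof. by apply: sym_connect_sym => a b; rewrite /within adj_sym andbCA. Qed.

Lemma withinS X Y a b : X \subset Y -> connect (within X) a b -> connect (within Y) a b.
Proof.
move=> XY; apply: connect_sub => c d /and3P[cX dX cd].
by apply: connect1; rewrite /within !(subsetP XY).
Qed.

Lemma connect_within_in Z s u : s \in Z -> connect (within Z) s u -> u \in Z.
Proof. by move=> sZ; move: u; apply: connect_ind => // x y _ _ /and3P[]. Qed.

(** A boolean form of connectedness, so that a maximal such set can be taken with [maxset]. *)
Definition rooted s Z := (s \in Z) && (Z \subset [set u | connect (within Z) s u]).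

Lemma rootedP s Z :
  reflect (s \in Z /\ forall u, u \in Z -> connect (within Z) s u) (rooted s Z).
Proof.
apply: (iffP andP) => -[sZ h]; split=> //.
  by move=> u /(subsetP h); rewrite inE.
by apply/subsetP=> u uZ; rewrite inE h.
Qed.

Lemma rooted1 s : rooted s [set s].
Proof. by apply/rootedP; split=> [|u]; rewrite inE // => /eqP->; exact: connect0. Qed.

Lemma rooted_add s X u x : rooted s X -> u \in X -> adj G u x -> rooted s (x |: X).
Proof.
case/rootedP=> sX conn uX ux; have sub := subsetU1 x X.
have connX w : w \in X -> connect (within (x |: X)) s w.
  by move=> wX; apply: withinS sub (conn _ wX).
apply/rootedP; split=> [|w]; rewrite in_setU1 ?sX ?orbT // => /orP[/eqP->|]; last exact: connX.
apply: connect_trans (connX _ uX) (connect1 _).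
by rewrite /within !in_setU1 uX eqxx orbT.
Qed.

Definition component s Z : {set V} := [set u | connect (within Z) s u].

Lemma component_rooted s Z : s \in Z -> rooted s (component s Z).
Proof.
move=> sZ; apply/rootedP; split=> [|u]; rewrite inE ?connect0 //.
move: u; apply: connect_ind => [|x y sx IH xy]; first exact: connect0.
apply: connect_trans IH (connect1 _); case/and3P: (xy) => xZ yZ axy.
by rewrite /within !inE sx axy (connect_trans sx) ?connect1.
Qed.

Lemma component_sub s Z : s \in Z -> component s Z \subset Z.
Proof. by move=> sZ; apply/subsetP=> u; rewrite inE; apply: connect_within_in. Qed.

Lemma sub_component s X Z : rooted s X -> X \subset Z -> X \subset component s Z.
Proof.
by case/rootedP=> _ conn XZ; apply/subsetP=> u /conn; rewrite inE; apply: withinS.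
Qed.

(** A neighbour of the component that lies in [Z] is already in the component. Lower bounds on
    [inner] for connected sets thus extend to all sets containing [s]. *)
Lemma inner_component s Z : s \in Z -> inner (component s Z) \subset inner Z.
Proof.
move=> sZ; apply/subsetP=> u /innerP[uC [w uw wC]].
have uZ := subsetP (component_sub sZ) _ uC.
apply/innerP; split=> //; exists w => //; apply: contra wC => wZ.
rewrite !inE in uC *; apply: connect_trans uC (connect1 _).
by rewrite /within uZ wZ.
Qed.

(* A linkage from [inner X] to [inner Y] inside [D := (Y :\: X) :|: inner X] is the
   orbit structure of a matching of [D :\: inner Y] into [D :\: inner X = Y :\: X]
   along edges and loops, so Menger's theorem reduces to Hall's: applied to [Q],
   Hall's condition is the minimality of [inner X] against
   [inner (X :|: N[Q])]. *)
Lemma linkage X Y :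
  X \subset Y ->
  (forall Z, X \subset Z -> Z \subset Y -> #|inner X| <= #|inner Z|) ->
  exists P : V -> {set V},
    [/\ {in inner X, forall a, P a \subset (Y :\: X) :|: inner X},
        {in inner X, forall a, a \in P a},
        {in inner X, forall a, exists2 b, b \in P a & b \in inner Y},
        {in inner X, forall a u, u \in P a -> connect (within (P a)) a u}
      & {in inner X &, forall a c u, u \in P a -> u \in P c -> a = c}].
Proof.
move=> XY minX; have [X0|[y0 _]] := set_0Vmem (inner X).
  by exists (fun=> set0); split=> a; rewrite X0 inE.
set D := (Y :\: X) :|: inner X.
have XX := inner_sub X.
have DY : D \subset Y by rewrite subUset subsetDl (subset_trans XX XY).
(* Loops let a vertex off the linkage be matched to itself. Targets avoid [X], so no orbit returns
   to a starting point in [inner X]. *)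
pose r x y := (y \in Y :\: X) && ((x == y) || adj G x y).
have [Q QA|f fr finj] := @Hall_matching _ _ y0 r (D :\: inner Y).
  set N := nbrs r Q.
  have NYX : N \subset Y :\: X by apply/subsetP=> y /nbrsP[x _ /andP[]].
  have ZY : X :|: N \subset Y by rewrite subUset XY (subset_trans NYX) ?subsetDl.
  have := minX _ (subsetUl X N) ZY; set Z := X :|: N => leZ.
  (* As [Q] avoids [inner Y], neighbours of [Q] lie in [Y], hence in [X] or [N]; so [Q] and
     [X :\: inner X] are interior to [Z]. With [#|Z| <= #|X| + #|N|] and [#|inner X| <= #|inner Z|]
     this gives [#|Q| <= #|N|]. *)
  have sub : Q :|: (X :\: inner X) \subset Z :\: inner Z.
    apply/subsetP=> x; rewrite in_setU => /orP[xQ|].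
      have := subsetP QA _ xQ; rewrite in_setD => /andP[xY xD].
      have xZ : x \in Z.
        rewrite in_setU; case/setUP: xD => [xYX|/(subsetP XX)->] //.
        by apply/orP; right; apply/nbrsP; exists x; rewrite // /r xYX eqxx.
      rewrite in_setD xZ andbT; apply/negP=> /innerP[_ [w xw]]; case/negP.
      have wY := notin_inner (subsetP DY _ xD) xY xw.
      rewrite in_setU; case: (boolP (w \in X)) => //= wX.
      by apply/nbrsP; exists x; rewrite // /r in_setD wX wY xw orbT.
    rewrite in_setD => /andP[xI xX]; rewrite in_setD in_setU xX andbT.
    apply/negP=> /innerP[_ [w xw]]; case/negP.
    by rewrite in_setU (notin_inner xX xI xw).
  have := subset_leq_card sub; rewrite cardsU.
  have -> : Q :&: (X :\: inner X) = set0.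
    apply/setP=> x; rewrite !in_setI in_setD in_set0; apply/negP=> /and3P[xQ xI xX].
    have := subsetP QA _ xQ; rewrite in_setD in_setU in_setD xX (negbTE xI).
    by rewrite andbF.
  rewrite cards0 subn0.
  have := cardsID (inner Z) Z; rewrite (setIidPr (inner_sub Z)).
  have := cardsID (inner X) X; rewrite (setIidPr XX).
  have : #|Z| <= #|X| + #|N| by exact: leq_card_setU.
  lia.
pose step : rel V := fun x y => (x \in D :\: inner Y) && (y == f x).
have fYX x : x \in D :\: inner Y -> f x \in Y :\: X by move=> /fr/andP[].
have fX x a : x \in D :\: inner Y -> a \in inner X -> f x <> a.
  by move=> /fYX + /(subsetP XX) aX e; rewrite e in_setD aX.
pose P a := [set u | connect step a u].
have PP a u : u \in P a -> u = a \/ exists2 x, x \in P a & step x u.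
  rewrite inE => /connect_last[|[x ax xu]]; first by left.
  by right; exists x; rewrite ?inE.
have PD a : a \in inner X -> P a \subset D.
  move=> aX; apply/subsetP=> u /PP[->|[x _ /andP[xA /eqP->]]].
    by rewrite in_setU aX orbT.
  by rewrite in_setU fYX.
have Pa a : a \in P a by rewrite inE.
exists P; split=> //.
(* On an orbit missing [inner Y], the injective [f] would map the finite set [P a] into
   [P a :\ a]. *)
- move=> a aX; apply/exists_inP; apply: contraT => /exists_inPn noB; exfalso.
  have PA u : u \in P a -> u \in D :\: inner Y.
    by move=> uP; rewrite in_setD noB // (subsetP (PD a aX)).
  have sub : f @: P a \subset P a :\ a.
    apply/subsetP=> _ /imsetP[u uP ->]; rewrite in_setD1.
    apply/andP; split; first by apply/eqP; apply: fX (PA _ uP) aX.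
    move: (uP); rewrite !inE => au; apply: connect_trans au (connect1 _).
    by rewrite /step PA ?eqxx.
  have := subset_leq_card sub.
  rewrite card_in_imset => [|x y xP yP]; last by apply: finj; apply: PA.
  by rewrite [X in X <= _](cardsD1 a) Pa add1n ltnn.
- move=> a aX u; rewrite inE; move: u.
  apply: connect_ind => [|x y ax IH xy]; first exact: connect0.
  have [xA /eqP ey] := andP xy; apply: connect_trans IH _.
  have /andP[_ /orP[/eqP e|axy]] := fr _ xA; first by rewrite ey -e.
  apply: connect1; rewrite /within !inE ax ey axy.
  by rewrite (connect_trans ax) // connect1 // /step xA eqxx.
(* By injectivity of [f], a common vertex can be traced back along the orbit of [c], so [c] lies on
   the orbit of [a]. Since [c] is not reached by any step, [c = a]. *)
- move=> a c aX cX u ua uc.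
  have back : u \in P a -> c \in P a.
    move: uc; rewrite inE; move: {ua} u.
    apply: connect_ind => // x y _ IH /andP[xA /eqP ey] /PP[eya|[z zP /andP[zA /eqP ez]]].
      by have := fX _ _ xA aX; rewrite -ey.
    by apply: IH; rewrite (finj x z) // -ey -ez.
  have /PP[//|[x _ /andP[xA /eqP e]]] := back ua.
  by have := fX _ _ xA cX; rewrite -e.
Qed.

(** The endpoint in [Z] of a boundary edge lies in [inner Z], so boundary edges are counted by pairs
    of a vertex of [inner Z] and a neighbour. *)
Lemma card_boundary_inner Z : #|boundary G Z| <= max_degree G * #|inner Z|.
Proof.
pose E := [set (p.1 |: [set p.2]) | p in
  [set p : V * V | (p.1 \in inner Z) && adj G p.1 p.2]].
have sub : boundary G Z \subset E.
  apply/subsetP=> e; rewrite !inE => /andP[/existsP[x /existsP[y /andP[xy /eqP->]]]].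
  have nxy : x != y by apply: contraTneq xy => ->; rewrite adj_irr.
  have inE2 a b : adj G a b -> a \in Z -> b \notin Z -> [set a; b] \in E.
    move=> ab aZ bZ; apply/imsetP; exists (a, b) => //; rewrite inE /= ab andbT.
    by apply/innerP; split=> //; exists b.
  case: (boolP (x \in Z)) => xZ; case: (boolP (y \in Z)) => yZ.
  - have /setIidPl-> : [set x; y] \subset Z by rewrite subUset !sub1set xZ.
    by rewrite cards2 nxy.
  - by move=> _; apply: inE2.
  - by move=> _; rewrite setUC; apply: inE2; rewrite // adj_sym.
  - have -> : [set x; y] :&: Z = set0; last by rewrite cards0.
    apply/setP=> z; rewrite !inE; apply/negP=> /andP[/orP[]/eqP->]; exact/negP.
apply: leq_trans (subset_leq_card sub) (leq_trans (leq_imset_card _ _) _).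
rewrite -sum1_card (eq_bigl (fun p : V * V => (p.1 \in inner Z) && adj G p.1 p.2)); last first.
  by move=> p; rewrite inE.
rewrite -(pair_big_dep (mem (inner Z)) (adj G) (fun _ _ => 1)) /=.
rewrite mulnC -sum_nat_const; apply: leq_sum => x _.
rewrite sum1_card; apply: leq_trans (leq_bigmax x); rewrite /degree cardsE.
exact: leqnn.
Qed.

(** A walk inside [Z] can be shortened to one without repetition, which has at most [#|Z|] vertices
    and so fewer edges. *)
Lemma rooted_path s Z u : rooted s Z -> u \in Z ->
  exists p, [/\ path (adj G) s p, last s p = u & size p < #|Z|].
Proof.
case/rootedP=> sZ conn uZ; case/connectP: (conn _ uZ) => p0 /shortenP[p pth uq _] e.
exists p; split=> //; first by apply: sub_path pth => a b /and3P[].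
rewrite -[(size p).+1]/(size (s :: p)) -(card_uniqP uq); apply: subset_leq_card.
apply/subsetP=> y; rewrite inE => /predU1P[->//|yp].
move: yp pth; clear -sZ; elim: p s sZ => //= z p IHp s sZ.
rewrite inE => /predU1P[->|yp] /andP[/and3P[_ zZ _] pth] //; exact: IHp pth.
Qed.

End InnerBoundary.

(** * Extending a subtree by one vertex *)

(** A path in [U] between two distinct neighbours of [x] would close up through [x] to a cycle with
    at least three vertices. *)
Lemma tree_unique_neighbour (W : finType) (T : sgraph W) t0 (U : {set W}) t u x :
  is_tree T -> rooted T t0 U -> x \notin U -> t \in U -> u \in U ->
  adj T t x -> adj T u x -> u = t.
Proof.
case=> _ _ acyc /rootedP[_ conn] xU tU uU tx ux; apply/eqP; apply: contraT => nut.
have : connect (within T U) t u.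
  by apply: connect_trans (conn _ uU); rewrite within_sym; apply: conn.
case/connectP=> p0 /shortenP[p pth uq _] e.
have pU : all (mem U) p.
  apply/allP=> y yp; elim: p t tU {tx nut uq e} pth yp => //= z p IHp t tU.
  case/andP=> /and3P[_ zU _] pth; rewrite inE => /predU1P[->//|]; exact: IHp pth.
have := acyc (x :: t :: p); rewrite /ucycle /= rcons_path -e ux adj_sym tx.
have -> : path (adj T) t p by apply: sub_path pth => a b /and3P[].
rewrite cons_uniq in uq; case/andP: (uq) => tp up; rewrite inE negb_or tp up /=.
have -> : x != t by apply: contraNneq xU => ->.
have -> : x \notin p by apply: contra xU => /(allP pU).
move=> /(_ isT); case: p e {pth uq pU tp up} => //= e.
by rewrite e eqxx in nut.
Qed.

Lemma connected_crossing (W : finType) (T : sgraph W) (U : {set W}) t0 w :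
  connect (adj T) t0 w -> t0 \in U -> w \notin U ->
  exists t x, [/\ t \in U, x \notin U & adj T t x].
Proof.
move=> tw t0U wU.
have [/exists_inP[t tU /existsP[x /andP[tx xU]]]|/exists_inPn no] :=
  boolP [exists t in U, [exists x, adj T t x && (x \notin U)]].
  by exists t, x.
case/negP: wU; move: w tw; apply: connect_ind => // x y _ xU xy.
have := no _ xU; rewrite negb_exists => /forallP/(_ y).
by rewrite xy negbK.
Qed.

(** * Growing a partial minor model *)

Section Growth.
Variables (V W : finType) (G : sgraph V) (T : sgraph W).
Implicit Types (X Y Z : {set V}) (U : {set W}) (phi : V -> option W) (v : W -> V).

(** [v t] is the vertex of [inner G X] from which the branch set of [t] can be continued. As [v] is
    injective on [U], the last clause makes it a bijection from [U] onto [inner G X]. *)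
Definition partial_model X U phi v : Prop :=
  [/\ forall a t, phi a = Some t -> a \in X /\ t \in U,
      forall t, t \in U -> phi (v t) = Some t /\ v t \in inner G X,
      forall a t, phi a = Some t -> connect (fibre_adj G phi) (v t) a,
      forall t u, t \in U -> u \in U -> adj T t u ->
        exists a b, [/\ phi a = Some t, phi b = Some u & adj G a b]
    & #|inner G X| <= #|U|].

Lemma fibre_adj_sym phi : connect_sym (fibre_adj G phi).
Proof.
apply: sym_connect_sym => a b; rewrite /fibre_adj adj_sym eq_sym.
by case: eqP => [->|] //; rewrite !andbF.
Qed.

Lemma fibre_adjS phi phi' :
  (forall a t, phi a = Some t -> phi' a = Some t) ->
  forall a b, connect (fibre_adj G phi) a b -> connect (fibre_adj G phi') a b.
Proof.
move=> ext; apply: connect_sub => a b /and3P[ab /eqP e na]; apply: connect1.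
case ea: (phi a) na => [t|] // _; rewrite ea in e.
by rewrite /fibre_adj ab (ext _ _ ea) (ext _ _ (esym e)) eqxx.
Qed.

(** The branch set of [t] is prolonged by the linkage path starting at [v t], and [v' t] is a vertex
    of that path in [inner G Y]. *)
Lemma partial_model_push X Y U phi v :
  partial_model X U phi v -> X \subset Y -> #|inner G Y| <= #|U| ->
  (forall Z, X \subset Z -> Z \subset Y -> #|U| <= #|inner G Z|) ->
  exists phi' v', partial_model Y U phi' v'.
Proof.
case=> dom vP conn edge cardX XY cardY minX.
have [|P [PD Pa PY Pconn Pdisj]] := @linkage _ G X Y XY.
  by move=> Z XZ ZY; apply: leq_trans cardX (minX _ XZ ZY).
have vin t : t \in U -> v t \in inner G X by case/vP.
pose phi' u := if phi u is Some t then Some t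
               else [pick t in U | u \in P (v t)].
have ext a t : phi a = Some t -> phi' a = Some t by rewrite /phi' => ->.
(* Old labels take precedence without conflict: a path meets [X] only in [inner G X], and
   disjointness forces the meeting vertex to be its start [v t]. *)
have phiP t u : t \in U -> u \in P (v t) -> phi' u = Some t.
  move=> tU uP; rewrite /phi'; case eu: (phi u) => [t'|].
    have [uX _] := dom _ _ eu.
    have uI : u \in inner G X.
      by have := subsetP (PD _ (vin _ tU)) _ uP; rewrite in_setU in_setD uX.
    have e : v t = u by apply: Pdisj uP (Pa _ uI); rewrite ?vin.
    by have [+ _] := vP _ tU; rewrite e eu.
  case: pickP => [t' /andP[t'U uP']|/(_ t)]; last by rewrite tU uP.
  have e : v t = v t' by apply: Pdisj uP uP'; apply: vin.
  by have [<- _] := vP _ tU; have [<- _] := vP _ t'U; rewrite e.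
have phi'P a t : phi' a = Some t -> t \in U /\ (phi a = Some t \/ a \in P (v t)).
  rewrite /phi'; case ea: (phi a) => [t'|].
    by case=> <-; have [_ ->] := dom _ _ ea; split=> //; left.
  by case: pickP => // t' /andP[t'U aP] [<-]; split=> //; right.
have connP t a : t \in U -> a \in P (v t) -> connect (fibre_adj G phi') (v t) a.
  move=> tU /(Pconn _ (vin _ tU)); apply: connect_sub => b c /and3P[bP cP bc].
  by apply: connect1; rewrite /fibre_adj bc (phiP t) // (phiP t c) ?eqxx.
have [v' v'P] : exists v' : W -> V, forall t, t \in U ->
    v' t \in P (v t) /\ v' t \in inner G Y.
  apply: (@fin_all_exists _ (fun=> V)
    (fun t b => t \in U -> b \in P (v t) /\ b \in inner G Y)) => t.
  case: (boolP (t \in U)) => [tU|_]; last by exists (v t).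
  by have [b bP bY] := PY _ (vin _ tU); exists b.
exists phi', v'; split=> //.
- move=> a t /phi'P[tU [/dom[aX _]|aP]]; split=> //; first exact: (subsetP XY).
  have := subsetP (PD _ (vin _ tU)) _ aP; rewrite in_setU in_setD => /orP[/andP[]|] //.
  by move=> /(subsetP (inner_sub G X)); apply: subsetP.
- by move=> t tU; have [bP bY] := v'P _ tU; rewrite (phiP t).
- move=> a t /phi'P[tU ha]; have [bP _] := v'P _ tU.
  apply: (@connect_trans _ _ (v t)); first by rewrite fibre_adj_sym connP.
  case: ha => [pa|]; last exact: connP.
  by apply: fibre_adjS ext _ _ (conn _ _ pa).
- move=> t u tU uU tu; have [a [b [pa pb ab]]] := edge _ _ tU uU tu.
  by exists a, b; split=> //; apply: ext.
Qed.

(** The new branch set is [x] alone. By uniqueness of [t], the edge from [v t] to [x] represents the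
    only new edge of the subtree. *)
Lemma partial_model_add X U phi v t t' x :
  partial_model X U phi v -> t \in U -> t' \notin U -> adj T t t' ->
  (forall u, u \in U -> adj T u t' -> u = t) ->
  x \notin X -> adj G (v t) x -> #|U| < #|inner G (x |: X)| ->
  exists phi' v', partial_model (x |: X) (t' |: U) phi' v'.
Proof.
case=> dom vP conn edge cardX tU t'U tt' uniq_t xX vx cardx.
have sub : inner G (x |: X) \subset x |: inner G X.
  apply/subsetP=> u /innerP[]; rewrite !in_setU1 => /orP[->//|uX] [w uw].
  rewrite in_setU1 negb_or => /andP[_ wX]; apply/orP; right.
  by apply/innerP; split=> //; exists w.
have xI : x \notin inner G X by apply: contra xX; apply: subsetP; apply: inner_sub.
(* The left side has more than [#|U|] elements and the right at most [#|U| + 1]. Hence every [v u],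
   including [v t], still has a neighbour outside [x |: X]. *)
have innerE : inner G (x |: X) = x |: inner G X.
  apply/eqP; rewrite eqEcard sub cardsU1 xI add1n.
  exact: leq_trans cardx.
have phix : phi x = None.
  by case e: (phi x) => [u|] //; have [] := dom _ _ e; rewrite (negbTE xX).
pose phi' u := if u == x then Some t' else phi u.
pose v' u := if u == t' then x else v u.
have ext a u : phi a = Some u -> phi' a = Some u.
  by rewrite /phi'; case: eqVneq => // ->; rewrite phix.
have v'E u : u \in U -> v' u = v u.
  by move=> uU; rewrite /v'; case: eqVneq => // e; rewrite -e uU in t'U.
have [phivt _] := vP _ tU.
exists phi', v'; split.
- move=> a u; rewrite /phi'; case: eqVneq => [-> [<-]|_ /dom[aX uU]]; first by rewrite !setU11.
  by rewrite !in_setU1 aX uU !orbT.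
- move=> u; rewrite in_setU1 innerE => /predU1P[->|uU].
    by rewrite /v' eqxx /phi' eqxx setU11.
  by have [/ext pu ui] := vP _ uU; rewrite v'E // pu in_setU1 ui orbT.
- move=> a u; rewrite {1}/phi'; case: eqVneq => [-> [<-]|_ pa].
    by rewrite /v' eqxx connect0.
  have [_ uU] := dom _ _ pa; rewrite v'E //.
  by apply: fibre_adjS ext _ _ (conn _ _ pa).
- have px : phi' x = Some t' by rewrite /phi' eqxx.
  move=> u w; rewrite !in_setU1 => /predU1P[->|uU] /predU1P[->|wU] uw.
  + by rewrite adj_irr in uw.
  + have -> : w = t by apply: uniq_t => //; rewrite adj_sym.
    by exists x, (v t); rewrite adj_sym vx px (ext _ t).
  + have -> : u = t by apply: uniq_t.
    by exists (v t), x; rewrite vx px (ext _ t).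
  + have [a [b [pa pb ab]]] := edge _ _ uU wU uw.
    by exists a, b; split=> //; apply: ext.
- by rewrite innerE !cardsU1 xI t'U !add1n ltnS.
Qed.

Variables (s : V) (B : {set V}).
(** Expansion enters the growth argument through this hypothesis and the next, with [B] the ball: a
    connected set with few inner vertices is small, so its neighbours stay in [B]. *)
Hypothesis inner_gt0 : forall Z, rooted G s Z -> Z \subset B -> 0 < #|inner G Z|.
Hypothesis room : forall Z, rooted G s Z -> Z \subset B -> #|inner G Z| <= #|W| ->
  forall u w, u \in Z -> adj G u w -> w \in B.

(** This serves twice in the next round: it puts [x] and all old ends on the inner boundary of
    [x |: X], and it supplies the lower bound required by the linkage. *)
Definition saturated X n : Prop :=
  [/\ rooted G s X, X \subset B
    & forall Z, rooted G s Z -> Z \subset B -> X \proper Z -> n < #|inner G Z|].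

Lemma partial_model_saturate X U phi v :
  partial_model X U phi v -> rooted G s X -> X \subset B ->
  (forall Z, rooted G s Z -> Z \subset B -> X \subset Z -> #|U| <= #|inner G Z|) ->
  exists Y phi' v', partial_model Y U phi' v' /\ saturated Y #|U|.
Proof.
move=> model rX XB minX; have [_ _ _ _ cardX] := model.
pose p Z := [&& rooted G s Z, Z \subset B, X \subset Z & #|inner G Z| <= #|U|].
have [|Y /maxsetP[/and4P[rY YB XY cardY] maxY] _] := @maxset_exists _ p X.
  by rewrite /p rX XB subxx.
have [|phi' [v' model']] := partial_model_push model XY cardY.
  (* An intermediate [Z] may be disconnected; the bound is applied to its component of [s], whose
     inner boundary is no larger. *)
  move=> Z XZ ZY; have [sX _] := rootedP _ _ _ rX.
  have sZ := subsetP XZ _ sX.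
  apply: leq_trans (subset_leq_card (inner_component G sZ)).
  apply: minX (component_rooted G sZ) _ (sub_component rX XZ).
  exact: subset_trans (component_sub G sZ) (subset_trans ZY YB).
exists Y, phi', v'; split=> //; split=> // Z rZ ZB YZ; rewrite ltnNge.
apply/negP=> cardZ; have e : Z = Y.
  apply: maxY (proper_sub YZ); rewrite /p rZ ZB cardZ (subset_trans XY) //.
  exact: proper_sub YZ.
by rewrite e properxx in YZ.
Qed.

(** Each round adds one tree vertex to the model and then saturates again. The start is the set
    [[set s]], whose nonempty inner boundary can only be [s]. *)
Lemma tree_partial_model n :
  is_tree T -> s \in B -> 0 < n <= #|W| ->
  exists t0 U X phi v,
    [/\ #|U| = n, rooted T t0 U, partial_model X U phi v & saturated X n].
Proof.
move=> tree sB; elim: n => // -[_ _|n IHn /andP[_ lt_nW]].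
  have [/card_gt0P[t0 _] _ _] := tree; exists t0, [set t0].
  have [||||Y [phi' [v' [model sat]]]] :=
    @partial_model_saturate [set s] [set t0] (fun a => if a == s then Some t0 else None)
      (fun=> s).
  - split=> [a t|t|a t|t u|].
    + by case: eqVneq => // -> [<-]; rewrite !set11.
    + rewrite inE eqxx => /eqP->; split=> //.
      have : 0 < #|inner G [set s]| by apply: inner_gt0; rewrite ?rooted1 ?sub1set.
      case/card_gt0P=> u uI.
      by have := subsetP (inner_sub G [set s]) _ uI; rewrite inE => /eqP e; rewrite e in uI.
    + by case: eqVneq => // -> _; exact: connect0.
    + by rewrite !inE => /eqP-> /eqP->; rewrite adj_irr.
    + by rewrite cards1 -(cards1 s) subset_leq_card ?inner_sub.
  - exact: rooted1.
  - by rewrite sub1set.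
  - by move=> Z rZ ZB _; rewrite cards1 inner_gt0.
  by rewrite cards1 in sat; exists Y, phi', v'; rewrite cards1 rooted1.
have [|t0 [U [X [phi [v [cardU rU model [rX XB sat]]]]]]] := IHn.
  by apply: ltnW.
have [w wU] : exists w, w \notin U.
  apply/existsP; rewrite -negb_forall; apply: contraTN lt_nW => /forallP all_U.
  rewrite -leqNgt -cardU; apply: subset_leq_card.
  by apply/subsetP=> a _; apply: all_U.
have [t0U _] := rootedP _ _ _ rU; have [_ connT _] := tree.
have [t [t' [tU t'U tt']]] := connected_crossing (connT t0 w) t0U wU.
have [_ vP _ _ cardX] := model.
have [_ /innerP[vX [x vx xX]]] := vP _ tU.
have rxX := rooted_add rX vX vx.
(* [room] applies because [#|inner G X| <= #|U| <= #|W|]. *)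
have xB : x \in B.
  apply: room rX XB _ _ _ vX vx; apply: leq_trans cardX _.
  exact: max_card.
have xXB : x |: X \subset B by rewrite subUset sub1set xB.
have grow Z : x |: X \subset Z -> X \proper Z.
  move=> xXZ; apply/properP; split; first exact: subset_trans (subsetU1 x X) xXZ.
  by exists x; rewrite ?(subsetP xXZ) ?setU11.
have [||phi1 [v1 model1]] := partial_model_add model tU t'U tt' _ xX vx.
- by move=> u uU ut'; apply: tree_unique_neighbour tree rU t'U tU uU tt' ut'.
- by rewrite cardU; apply: sat rxX xXB (grow _ (subxx _)).
have cardU' : #|t' |: U| = n.+2 by rewrite cardsU1 t'U cardU.
have [|Y [phi2 [v2 [model2 sat2]]]] := partial_model_saturate model1 rxX xXB.
  by move=> Z rZ ZB /grow; rewrite cardU'; apply: sat.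
exists t0, (t' |: U), Y, phi2, v2; split=> //; last by rewrite -cardU'.
exact: rooted_add rU tU tt'.
Qed.

(** For [n = #|W|] the subtree is all of [T], and the branch sets lie in [X], hence in [B]. *)
Lemma tree_minor_induced : is_tree T -> s \in B -> has_minor T (induced G B).
Proof.
move=> tree sB; have [W0 _ _] := tree.
have [|t0 [U [X [phi [v [cardU _ [dom vP conn edge _] [_ XB _]]]]]]] :=
  @tree_partial_model #|W| tree sB; first by rewrite W0 leqnn.
have inU t : t \in U.
  have /setP-> : U = setT by apply/eqP; rewrite eqEcard subsetT cardsT cardU leqnn.
  by rewrite inE.
have inB a t : phi a = Some t -> a \in B by case/dom=> /(subsetP XB).
apply: (@has_minor_of_model _ _ _ _ (fun x => phi (val x))); split.
- move=> t; have [pv _] := vP _ (inU t).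
  by exists (Sub (v t) (inB _ _ pv)).
- move=> a b e na; case ea: (phi (val a)) na => [t|] // _.
  have eb : phi (val b) = Some t by rewrite -e.
  have cab : connect (fibre_adj G phi) (val a) (val b).
    by apply: connect_trans (conn _ _ eb); rewrite fibre_adj_sym; apply: conn.
  have := @connect_homo _ _ _ (fibre_adj (induced G B) (fun x => phi (val x)))
    (insubd a) _ _ _ cab.
  rewrite !valKd; apply=> c d /and3P[cd /eqP ecd nc]; apply: connect1.
  case ec: (phi c) nc => [u|] // _; rewrite ec in ecd.
  have cB := inB _ _ ec; have dB := inB _ _ (esym ecd).
  by rewrite /fibre_adj /= /induced_adj !insubdK // cd ec -ecd eqxx.
- move=> t u tu; have [a [b [pa pb ab]]] := edge _ _ (inU t) (inU u) tu.
  by exists (Sub a (inB _ _ pa)), (Sub b (inB _ _ pb)).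
Qed.

End Growth.

(* From expansion to tree minors *)
From mathcomp Require Import all_classical all_reals ereal.

Import Order.TTheory GRing.Theory Num.Theory.
Local Open Scope ring_scope.

Lemma gball_path (R : realType) (V : finType) (G : sgraph V) s (p : seq V) (r : R) :
  path (adj G) s p -> (size p)%:R <= r -> last s p \in gball G s r.
Proof.
move=> pth le_r; rewrite inE.
apply: (@le_trans _ _ (size p)%:R%:E); last by rewrite lee_fin.
by apply: ereal_inf_lbound; exists p.
Qed.

(** Expansion and the edge count give [eps * #|Z| * d <= d * #|inner G Z|]; then [d] cancels. *)
Lemma expanding_inner (R : realType) (V : finType) (G : sgraph V) d s (r eps : R) (Z : {set V}) :
  (0 < d)%N -> max_degree G = d -> expanding_nbhd G d s r eps ->
  Z \subset gball G s r -> eps * #|Z|%:R <= #|inner G Z|%:R.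
Proof.
move=> d0 maxd expand ZB.
have d0' : 0 < d%:R :> R by rewrite ltr0n.
rewrite -(ler_pM2r d0'); apply: le_trans (expand Z _) _.
  by move=> u /(fintype.subsetP ZB); rewrite inE.
by rewrite -natrM ler_nat mulnC -maxd card_boundary_inner.
Qed.

Theorem theorem7p9 (R : realType) :
  exists eps0 : R, 0 < eps0 /\
  forall (eps : R) (k d : nat),
    0 < eps -> eps <= eps0 -> (0 < k)%N -> (0 < d)%N ->
  forall (N : nat) (G : sgraph 'I_N) (s : 'I_N),
    max_degree G = d ->
  let r : R := k%:R * (4 * d%:R / eps) ^+ (4 * k + 2) in
    expanding_nbhd G d s r eps ->
  forall (W : finType) (T : sgraph W),
    is_tree T -> (#|W| <= k)%N ->
    has_minor T (induced G (gball G s r)).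
Proof.
(* With [eps <= 1] the base [4 * d / eps] is at least 1, so its powers are at least the base, which
   dominates [1 / eps]. *)
exists 1; split=> // eps k d eps0 eps1 k0 d0 N G s maxd r expand W T tree Wk.
have r_ge : k%:R / eps <= r.
  rewrite /r ler_wpM2l //.
  have base : eps^-1 <= 4 * d%:R / eps.
    rewrite ler_peMl ?invr_ge0 ?(ltW eps0) // -natrM ler1n muln_gt0 //.
  have base1 : 1 <= 4 * d%:R / eps by apply: le_trans base; rewrite invf_ge1.
  apply: le_trans base _; rewrite addn2 exprS ler_peMr ?exprn_ege1 //.
  exact: le_trans base1.
have r0 : 0 <= r by apply: le_trans r_ge; rewrite divr_ge0 // ltW.
have sB : s \in gball G s r by apply: (@gball_path _ _ _ s [::]).
have ineq (Z : {set _}) := @expanding_inner _ _ _ _ _ _ _ Z d0 maxd expand.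
apply: (@tree_minor_induced _ _ _ _ s) => // [Z rZ ZB|Z rZ ZB cardZ u w uZ uw].
  have [sZ _] := rootedP _ _ _ rZ.
  rewrite -(ltr0n R); apply: lt_le_trans (ineq _ ZB).
  by rewrite mulr_gt0 // ltr0n; apply/card_gt0P; exists s.
(* The path to [u] has fewer than [#|Z|] edges, which leaves one for the step to [w]; and
   [#|Z| <= k / eps <= r]. *)
have [p [pth pu szp]] := rooted_path rZ uZ.
have -> : w = last s (rcons p w) by rewrite last_rcons.
apply: gball_path; first by rewrite rcons_path pth pu.
apply: le_trans r_ge; rewrite ler_pdivlMr // mulrC size_rcons.
apply: le_trans (le_trans (ineq _ ZB) _); first by rewrite ler_pM2l // ler_nat.
by rewrite ler_nat (leq_trans cardZ).
Qed.
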